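(* Let $f:\mathcal{X}\times\Theta\to\mathbb{R}$ be a compositional constraint function with $C\ge1$ components (as defined in the context), let $\gamma>0$ be the margin parameter, and let $(\theta_i)_{1\le i\le N}$ be independent copies of the random variable $\theta\in\Theta$. Then, for any $N$ larger than or equal to the sample complexity $$N(\epsilon,\delta)=\frac{\left(\frac2\gamma\sum_{k=1}^C\tau_k\Lambda_k+\sqrt{\log\frac{1}{\delta^{1/2}}}\right)^2}{\epsilon^2},$$ the probability of violation $V(x)$ of any $x\in\mathcal{X}$ is less than or equal to $\hat V_\gamma(x)+\epsilon$ with probability at least $1-\delta$. In addition, if the hard-margin scenario program ''find $x\in\mathcal{X}$ such that $f(x,\theta_i)\le-\gamma$ for $i=1,\dots,N$'' is feasible, then all its solutions $\hat x$ satisfy $\hat V_\gamma(\hat x)=0$, and the bound $V(\hat x)\le\epsilon$ holds with probability at least $1-\delta$ for any $N\ge N(\epsilon,\delta)$.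
   Context: Compositional constraint function: for $k=1,\dots,C$ let $f_k(x,\theta)=\psi_k(\theta)^\top\phi_k(x)+\eta_k(\theta)$ with functions $\psi_k:\Theta\to\mathbb{R}^{n_k}$, $\phi_k:\mathcal{X}\to\mathbb{R}^{n_k}$, $\eta_k:\Theta\to\mathbb{R}$. Let $\varphi_k:\mathbb{R}\to\mathbb{R}$ ($k=1,\dots,C$) and $\rho_k:\mathbb{R}\to\mathbb{R}$ ($k=2,\dots,C$) be Lipschitz continuous functions, and for $k=2,\dots,C$ let $g_k$ be one of the binary operators $(a,b)\mapsto\max(a,b)$, $(a,b)\mapsto\min(a,b)$, $(a,b)\mapsto a+b$, $(a,b)\mapsto a-b$. Define $f^1(x,\theta)=\varphi_1(f_1(x,\theta))$ and, for $k\ge2$, $f^k(x,\theta)=\rho_k\big(g_k(f^{k-1}(x,\theta),\varphi_k(f_k(x,\theta)))\big)$; then $f=f^C$. Moreover $\tau_k=\sup_{\theta\in\Theta}\|\psi_k(\theta)\|$ and $\Lambda_k=\sup_{x\in\mathcal{X}}\|\phi_k(x)\|$ with the Euclidean norm. $V(x)=P\{f(x,\theta)>0\}$ is the probability of violation, where $P$ is the distribution of $\theta$. The margin loss is $\ell_\gamma(x,\theta)=1$ if $f(x,\theta)\ge 0$, $1+f(x,\theta)/\gamma$ if $-\gamma<f(x,\theta)<0$, and $0$ if $f(x,\theta)\le-\gamma$; the empirical margin risk is $\hat V_\gamma(x)=\frac1N\sum_{i=1}^N\ell_\gamma(x,\theta_i)$. Here $\epsilon$ is the prescribed threshold and $\delta$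 the confidence parameter; probabilities ''at least $1-\delta$'' are on the random draw of $(\theta_i)_{1\le i\le N}$.
   Formalization: The Lipschitz continuous functions φ_k and ρ_k are assumed to be Lipschitz with constant 1; with arbitrary Lipschitz constants the claim is false, since N(ε,δ) contains no such constant and rescaling φ_k against the feature map makes τ_kΛ_k arbitrarily small. *)

(* Defs.v *)
From HB Require Import structures.
From mathcomp Require Import all_boot all_order all_algebra.
From mathcomp Require Import all_classical all_reals all_analysis.
Set Implicit Arguments.
Unset Strict Implicit.
Unset Printing Implicit Defensive.
Import Order.TTheory GRing.Theory Num.Theory.
Import numFieldNormedType.Exports.
Local Open Scope classical_set_scope.
Local Open Scope ring_scope.

(* The library norm on matrices is the max norm, hence this definition. *)
Definition euclidean_norm (R : realType) (n : nat) (v : 'cV[R]_n) : R :=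
  Num.sqrt (\sum_(i < n) v i 0 ^+ 2).

Inductive combination := CombMax | CombMin | CombAdd | CombSub.

Definition combine (R : realType) (g : combination) (a b : R) : R :=
  match g with
  | CombMax => Num.max a b
  | CombMin => Num.min a b
  | CombAdd => a + b
  | CombSub => a - b
  end.

(* Components are numbered from 1, and every family is indexed by nat: with C
   components, only the indices 1 <= k <= C of the families dim, psi, phi, eta,
   outer and 2 <= k <= C of the families link, comb are ever used.  The
   functions varphi_k and rho_k are [outer k] and [link k]. *)
Record composition (R : realType) (X T : Type) := Composition {
  dim : nat -> nat;
  psi : forall k, T -> 'cV[R]_(dim k);
  phi : forall k, X -> 'cV[R]_(dim k);
  eta : nat -> T -> R;
  outer : nat -> R -> R;
  link : nat -> R -> R;
  comb : nat -> combination }.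

Section Composition.
Context (R : realType) (X T : Type) (F : composition R X T).

Definition component (k : nat) (x : X) (t : T) : R :=
  ((psi F k t)^T *m phi F k x) 0 0 + eta F k t.

(* [partial_composition C] is f^C; the value at 0 is junk. *)
Fixpoint partial_composition (k : nat) (x : X) (t : T) : R :=
  match k with
  | 0%N => 0
  | k'.+1 =>
      if k' == 0%N then outer F k (component k x t)
      else link F k (combine (comb F k) (partial_composition k' x t)
                             (outer F k (component k x t)))
  end.

(* All Lipschitz constants are 1: no such constant occurs in
   [sample_complexity]. *)
Definition nonexpansive_composition (C : nat) : Prop :=
  (forall k, (1 <= k <= C)%N -> (1 : R).-lipschitz (outer F k)) /\
  (forall k, (2 <= k <= C)%N -> (1 : R).-lipschitz (link F k)).

(* Suprema are taken in the extended reals, so that an unbounded family yields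
   +oo (and not the junk value of the real-valued sup); products follow the
   convention 0 * +oo = 0. *)
Definition tau (k : nat) : \bar R :=
  ereal_sup [set (euclidean_norm (psi F k t))%:E | t in [set: T]].

Definition Lambda (k : nat) : \bar R :=
  ereal_sup [set (euclidean_norm (phi F k x))%:E | x in [set: X]].

Definition sample_complexity (C : nat) (gamma eps delta : R) : \bar R :=
  (((2 / gamma)%:E * (\sum_(1 <= k < C.+1) tau k * Lambda k)
     + (Num.sqrt (ln (1 / delta `^ (1 / 2))))%:E) ^+ 2
   * ((eps ^+ 2)^-1)%:E)%E.

End Composition.

Section Risk.
Context (R : realType) (X : Type).

Definition violation d (T : measurableType d) (P : probability T R)
    (f : X -> T -> R) (x : X) : \bar R :=
  P [set t | 0 < f x t].

Definition margin_loss (gamma u : R) : R :=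
  if 0 <= u then 1 else if - gamma < u then 1 + u / gamma else 0.

Definition empirical_margin_risk (T : Type) (gamma : R) (f : X -> T -> R)
    (N : nat) (s : 'I_N -> T) (x : X) : R :=
  N%:R^-1 * \sum_(i < N) margin_loss gamma (f x (s i)).

Definition hard_margin_solution (T : Type) (gamma : R) (f : X -> T -> R)
    (N : nat) (s : 'I_N -> T) (x : X) : Prop :=
  forall i, f x (s i) <= - gamma.

End Risk.

Section Sampling.
Context d d' (W : measurableType d) (T : measurableType d') (R : realType).

Definition mutually_independent (Q : probability W R) (N : nat)
    (theta : 'I_N -> {RV Q >-> T}) : Prop :=
  forall (J : {set 'I_N}) (A : 'I_N -> set T), (forall i, measurable (A i)) ->
    Q (\bigcap_(i in [set` J]) (theta i @^-1` A i)) =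
    (\prod_(i in J) Q (theta i @^-1` A i))%E.

Definition independent_copies (P : probability T R) (Q : probability W R)
    (N : nat) (theta : 'I_N -> {RV Q >-> T}) : Prop :=
  mutually_independent theta /\
  (forall i A, measurable A -> distribution Q (theta i) A = P A).

(* "E holds with probability at least p".  For measurable E this is p <= Q E;
   for other sets, on which Q is a meaningless set function, it is the inner
   probability that has to be at least p. *)
Definition holds_with_probability (Q : probability W R) (p : R) (E : set W) :
    Prop :=
  exists A : set W, [/\ measurable A, A `<=` E & (p%:E <= Q A)%E].

End Sampling.

(* Main.v *)
Require Import Defs.
From HB Require Import structures.
From mathcomp Require Import all_boot all_order all_algebra.
From mathcomp Require Import all_classical all_reals all_analysis.
From mathcomp Require Import measurable_realfun ring lra.
Set Implicit Arguments.
Unset Strict Implicit.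
Unset Printing Implicit Defensive.
Import Order.TTheory GRing.Theory Num.Theory.
Import numFieldNormedType.Exports.
Local Open Scope classical_set_scope.
Local Open Scope ring_scope.

(* For finitely many points x and finitely many values of theta, the expected
   maximal deviation between mean and empirical losses is at most the Rademacher
   complexity of twice the losses (symmetrization), and McDiarmid's inequality
   controls the fluctuation around it.  The complexity is bounded for every fixed
   sample: it is not increased by Lipschitz maps, it is subadditive under +, -,
   max and min (as max (a, b) = (a + b + |a - b|) / 2), and for a linear part it is
   at most tau Lambda sqrt N.  General theta is reduced to finitely many cells on
   which all losses are almost constant, and general X to countably many points,
   since the linear parts depend on x through a vector of finite dimension. *)

(** Only the maps [f x] are assumed measurable: [X] carries no structure, and [psi] and [phi] are
    arbitrary, so a supremum over [X] cannot simply be integrated. Hence symmetrization and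
    concentration are carried out for finite weights, by induction on the sample, with an arbitrary
    offset [a i] that collects the terms already drawn. The resulting tail bound does not involve
    the number of points x, so no union bound is paid and the passage to countably many points is a
    monotone limit. Constants: symmetrization doubles the loss and the margin loss has Lipschitz
    constant 1 / gamma, whence 2 / gamma; losses lie in [0, 1], so one draw moves the deviation sum
    by at most 1, and exceeding the mean bound by D has probability at most exp (- 2 D^2 / N), which
    the term with delta^(1/2) makes at most delta. *)

Section FiniteMax.
Context (R : realType) (I : finType) (i0 : I).

Definition fmax (a : I -> R) : R := a [arg max_(i > i0) a i]%O.

Lemma fmax_ge a i : a i <= fmax a.
Proof. by rewrite /fmax; case: arg_maxP => // j _; exact. Qed.

Lemma fmaxP a : exists i, fmax a = a i.
Proof. by eexists. Qed.

Lemma fmax_le a c : (forall i, a i <= c) -> fmax a <= c.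
Proof. by move=> ac; have [i ->] := fmaxP a. Qed.

End FiniteMax.

(** * Rademacher averages of finite classes, and contraction *)

Section Rademacher.
Context (R : realType) (I : finType) (i0 : I) (S : Type).
Implicit Types (h g : I -> S -> R) (s : seq S) (a b u : I -> R).

(* Expectation, over independent random signs, of the maximum over i of
   a i + sum_t (sign of t) * h i t, where t runs through s. *)
Fixpoint rademacher h s a : R :=
  match s with
  | [::] => fmax i0 a
  | t :: s' => (rademacher h s' (fun i => a i + h i t)
                + rademacher h s' (fun i => a i - h i t)) / 2
  end.

(** On the empty sample, let [i] and [j] maximize the two left terms: their sum is a i + a j + (u' i
    - u' j), at most a i + a j + |u i - u j|, which one of the two assignments of [i] and [j] to the
    right-hand maxima attains. Further signs only shift [a]. *)
Lemma rademacher_two_point h s a u u' :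
  (forall i j, `|u' i - u' j| <= `|u i - u j|) ->
  rademacher h s (fun i => a i + u' i) + rademacher h s (fun i => a i - u' i)
  <= rademacher h s (fun i => a i + u i) + rademacher h s (fun i => a i - u i).
Proof.
move=> uu'; elim: s a => [|t s IH] a /=.
  have [i ->] := fmaxP i0 (fun i => a i + u' i).
  have [j ->] := fmaxP i0 (fun i => a i - u' i).
  have := uu' i j; have := ler_norm (u' i - u' j).
  have := fmax_ge i0 (fun i => a i + u i) i.
  have := fmax_ge i0 (fun i => a i - u i) j.
  have := fmax_ge i0 (fun i => a i + u i) j.
  have := fmax_ge i0 (fun i => a i - u i) i.
  by case: (ger0P (u i - u j)) => /=; lra.
have := IH (fun i => a i + h i t); have := IH (fun i => a i - h i t).
have E1 v : (fun i => a i + v i + h i t) = (fun i => a i + h i t + v i).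
  by apply/funext => i; ring.
have E2 v : (fun i => a i + v i - h i t) = (fun i => a i - h i t + v i).
  by apply/funext => i; ring.
rewrite !E1 !E2.
lra.
Qed.

(** Signs are exchanged one at a time. Only increments in the index at a fixed [t] are compared, so
    the contraction may vary with [t]. *)
Lemma rademacher_contraction h h' s a :
  (forall t i j, `|h' i t - h' j t| <= `|h i t - h j t|) ->
  rademacher h' s a <= rademacher h s a.
Proof.
move=> hh'; elim: s a => [//|t s IH] a /=.
rewrite ler_pM2r ?invr_gt0//.
apply: le_trans (rademacher_two_point h s a (hh' t)).
by rewrite lerD.
Qed.

Lemma rademacherD h g s a b :
  rademacher (fun i t => h i t + g i t) s (fun i => a i + b i)
  <= rademacher h s a + rademacher g s b.
Proof.
elim: s a b => [|t s IH] a b /=.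
  by apply: fmax_le => i; rewrite lerD ?fmax_ge.
have := IH (fun i => a i + h i t) (fun i => b i + g i t).
have := IH (fun i => a i - h i t) (fun i => b i - g i t).
have -> : (fun i => a i + b i + (h i t + g i t)) =
          (fun i => a i + h i t + (b i + g i t)).
  by apply/funext => i; ring.
have -> : (fun i => a i + b i - (h i t + g i t)) =
          (fun i => a i - h i t + (b i - g i t)).
  by apply/funext => i; ring.
lra.
Qed.

Lemma rademacherN h s a : rademacher (fun i t => - h i t) s a = rademacher h s a.
Proof.
elim: s a => [//|t s IH] a /=.
rewrite !IH addrC; congr ((rademacher h s _ + _) / 2).
by apply/funext => i; rewrite opprK.
Qed.

Lemma rademacherZ h s c a : 0 <= c ->
  rademacher (fun i t => c * h i t) s (fun i => c * a i) = c * rademacher h s a.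
Proof.
move=> c0; elim: s a => [|t s IH] a /=.
  apply/le_anti/andP; split.
    by apply: fmax_le => i; rewrite ler_wpM2l ?fmax_ge.
  by have [i ->] := fmaxP i0 a; exact: (fmax_ge i0 (fun i => c * a i) i).
rewrite mulrA mulrDr -!IH; congr ((rademacher _ s _ + rademacher _ s _) / 2).
  by apply/funext => i; ring.
by apply/funext => i; ring.
Qed.

Lemma rademacher_const (k : S -> R) s : rademacher (fun _ => k) s (fun=> 0) = 0.
Proof.
(* The signs move the offset away from 0, but it stays constant in the index. *)
suff H c : rademacher (fun _ => k) s (fun=> c) = c by [].
elim: s c => [|t s IH] c /=.
  by have [i ->] := fmaxP i0 (fun=> c).
by rewrite !IH; lra.
Qed.

End Rademacher.

(** * Rademacher averages along a composition *)

Section Composition.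
Context (R : realType) (I : finType) (i0 : I) (X T : Type).
Context (F : composition R X T) (x : I -> X).

Local Notation rad h s := (rademacher i0 h s (fun=> 0)).

Lemma rademacher_add (h g : I -> T -> R) s :
  rad (fun i t => h i t + g i t) s <= rad h s + rad g s.
Proof.
have := rademacherD i0 h g s (fun=> 0) (fun=> 0).
by rewrite (_ : (fun=> 0 + 0) = (fun=> 0))//; apply/funext => i; rewrite addr0.
Qed.

Lemma rademacher_sub (h g : I -> T -> R) s :
  rad (fun i t => h i t - g i t) s <= rad h s + rad g s.
Proof.
by rewrite -[X in _ <= _ + X]rademacherN; exact: rademacher_add.
Qed.

Lemma rademacher_abs_sub (h g : I -> T -> R) s :
  rad (fun i t => `|h i t - g i t|) s <= rad h s + rad g s.
Proof.
apply: le_trans (rademacher_sub h g s).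
by apply: rademacher_contraction => t i j; exact: ler_dist_dist.
Qed.

Lemma rademacher_scale (h : I -> T -> R) s c : 0 <= c ->
  rad (fun i t => c * h i t) s = c * rad h s.
Proof.
move=> c0; rewrite -rademacherZ//; congr rademacher.
by apply/funext => i; rewrite mulr0.
Qed.

(** For max and min, the terms h + g and |h - g| each cost both averages and the factor 1/2 restores
    the total, so no constant accumulates with the depth of the composition. *)
Lemma rademacher_combine o (h g : I -> T -> R) s :
  rad (fun i t => combine o (h i t) (g i t)) s <= rad h s + rad g s.
Proof.
have half2 : 0 <= 2^-1 :> R by rewrite invr_ge0.
case: o => /=; last 2 first.
- exact: rademacher_add.
- exact: rademacher_sub.
- have -> : (fun i t => Num.max (h i t) (g i t)) =
      (fun i t => 2^-1 * ((h i t + g i t) + `|h i t - g i t|)).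
    by apply/funext => i; apply/funext => t; rewrite maxr_absE mulrC.
  rewrite rademacher_scale//.
  have := rademacher_add (fun i t => h i t + g i t) (fun i t => `|h i t - g i t|) s.
  have := rademacher_add h g s; have := rademacher_abs_sub h g s; lra.
- have -> : (fun i t => Num.min (h i t) (g i t)) =
      (fun i t => 2^-1 * ((h i t + g i t) - `|h i t - g i t|)).
    by apply/funext => i; apply/funext => t; rewrite minr_absE mulrC.
  rewrite rademacher_scale//.
  have := rademacher_sub (fun i t => h i t + g i t) (fun i t => `|h i t - g i t|) s.
  have := rademacher_add h g s; have := rademacher_abs_sub h g s; lra.
Qed.

Lemma lipschitz1P (u : R -> R) : (1 : R).-lipschitz u ->
  forall y z, `|u y - u z| <= `|y - z|.
Proof. by move=> lu y z; have := lu (y, z) (conj Logic.I Logic.I); rewrite /= mul1r. Qed.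

Definition linear_part k (y : X) (t : T) : R := ((psi F k t)^T *m phi F k y) 0 0.

(** The term [eta] does not depend on the point, so it cancels in the increments that contraction
    compares. *)
Lemma rademacher_outer k s : (1 : R).-lipschitz (outer F k) ->
  rad (fun i t => outer F k (component F k (x i) t)) s
  <= rad (fun i => linear_part k (x i)) s.
Proof.
move=> lo; apply: rademacher_contraction => t i j.
apply: le_trans (lipschitz1P lo _ _) _.
by rewrite /component /linear_part opprD addrACA subrr addr0.
Qed.

Lemma rademacher_composition C s : nonexpansive_composition F C -> (1 <= C)%N ->
  rad (fun i => partial_composition F C (x i)) s
  <= \sum_(1 <= k < C.+1) rad (fun i => linear_part k (x i)) s.
Proof.
move=> [lo ll].
suff H k : (1 <= k <= C)%N -> rad (fun i => partial_composition F k (x i)) s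
    <= \sum_(1 <= j < k.+1) rad (fun i => linear_part j (x i)) s.
  by move=> C1; apply: H; rewrite C1 leqnn.
elim: k => [//|[|k] IH] /andP[_ kC] /=.
  by rewrite big_nat1; apply: rademacher_outer; exact: lo.
rewrite big_nat_recr//=.
apply: (@le_trans _ _ (rad (fun i t => combine (comb F k.+2)
    (partial_composition F k.+1 (x i) t)
    (outer F k.+2 (component F k.+2 (x i) t))) s)).
  by apply: rademacher_contraction => t i j; apply: lipschitz1P; exact: ll.
apply: le_trans (rademacher_combine _ _ _ _) _.
apply: lerD; last by apply: rademacher_outer; exact: lo.
by apply: IH; exact: ltnW.
Qed.

End Composition.

(** * Real inequalities behind Hoeffding's lemma *)

Section RealFacts.
Context (R : realType).

Lemma ge0_of_derive_ge0 (f f' : R -> R) (u : R) :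
  (forall v, is_derive v (1 : R) f (f' v)) -> f 0 = 0 ->
  (forall v, 0 <= v -> 0 <= f' v) -> 0 <= u -> 0 <= f u.
Proof.
move=> df f0 f'0 u0; rewrite -f0.
apply: (@ger0_derive1_le_cc R f 0 u).
- by move=> x _; exact: ex_derive.
- move=> x; rewrite in_itv/= => /andP[x0 _].
  by rewrite derive1E (@derive_val _ _ _ _ _ _ _ (df x)); exact: f'0 (ltW _).
- apply: continuous_subspaceT => x; apply: differentiable_continuous.
  by apply/derivable1_diffP; exact: ex_derive.
- by rewrite in_itv/= lexx.
- by rewrite in_itv/= lexx andbT.
- by [].
Qed.

(* The exponent on the right exceeds the logarithm of the left-hand side by a
   function of u that vanishes to first order at 0, and whose second derivative
   1/4 - r (1 - r) is nonnegative. *)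
Lemma two_point_mgf (q u : R) : 0 <= q <= 1 -> 0 <= u ->
  1 - q + q * expR u <= expR (q * u + u ^+ 2 / 8).
Proof.
move=> /andP[q0 q1] u0.
pose D v : R := 1 - q + q * expR v.
have D0 v : 0 < D v.
  have := expR_gt0 v; rewrite /D => e0.
  have [->|qn] := eqVneq q 0; first by lra.
  have : 0 < q * expR v by rewrite mulr_gt0// lt_neqAle eq_sym qn.
  by lra.
have dD v : is_derive v (1 : R) D (q * expR v).
  rewrite /D; apply: is_derive_eq; rewrite /GRing.scale/=; ring.
pose g v : R := q * v + v ^+ 2 / 8 - ln (D v).
pose g' v : R := q + v / 4 - q * expR v / D v.
pose g'' v : R := 1 / 4 - (q * expR v / D v) * (1 - q * expR v / D v).
have dg v : is_derive v (1 : R) g (g' v).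
  have dl : is_derive v (1 : R) (fun v => ln (D v)) ((D v)^-1 * (q * expR v)).
    by have := @is_derive1_comp R (@ln R) D v _ _ (is_derive1_ln (D0 v)) (dD v);
      rewrite /GRing.scale/=.
  rewrite /g /g'; apply: is_derive_eq; rewrite /GRing.scale/= /GRing.scale/=. have nz := lt0r_neq0 (D0 v); field => //.
have dg' v : is_derive v (1 : R) g' (g'' v).
  have dV := is_deriveV (lt0r_neq0 (D0 v)).
  rewrite /g' /g''; apply: is_derive_eq; rewrite /GRing.scale/=.
  have := lt0r_neq0 (D0 v); move=> nz; field => //.
have g0 : g 0 = 0 by rewrite /g /D expR0 (_ : 1 - q + _ = 1) ?ln1; [lra|ring].
have g'0 : g' 0 = 0 by rewrite /g' /D expR0 (_ : 1 - q + _ = 1) ?divr1; [lra|ring].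
have g''0 v : 0 <= g'' v.
  rewrite /g''; set r := _ / D v.
  have -> : 1 / 4 - r * (1 - r) = (r - 1 / 2) ^+ 2 by field.
  exact: sqr_ge0.
have : 0 <= g u.
  apply: ge0_of_derive_ge0 dg g0 _ u0 => v v0.
  by apply: ge0_of_derive_ge0 dg' g'0 _ v0.
rewrite /g subr_ge0 => H; rewrite -/(D u).
by rewrite -[D u]lnK ?posrE// ler_expR.
Qed.

(** The tangent of exp at u q lies below exp at 0 and at u; averaging these two bounds with weights
    1 - q and q cancels the linear terms. *)
Lemma expR_chord (q u : R) : 0 <= q <= 1 ->
  expR (u * q) <= 1 - q + q * expR u.
Proof.
move=> /andP[q0 q1]; set c := expR (u * q).
have c0 : 0 <= c by exact: expR_ge0.
have H1 : c * (1 - u * q) <= 1.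
  rewrite [leRHS](_ : 1 = c * expR (- (u * q))); last first.
    by rewrite /c -expRD subrr expR0.
  by rewrite ler_wpM2l// expR_ge1Dx.
have H2 : c * (1 + u * (1 - q)) <= expR u.
  have -> : expR u = c * expR (u * (1 - q)) by rewrite /c -expRD; congr expR; ring.
  by rewrite ler_wpM2l// expR_ge1Dx.
have := ler_wpM2l q0 H2.
have : (1 - q) * (c * (1 - u * q)) <= (1 - q) * 1 by rewrite ler_wpM2l ?subr_ge0.
have -> : (1 - q) * (c * (1 - u * q)) =
  c - q * (c * (1 + u * (1 - q))) by ring.
lra.
Qed.

End RealFacts.

(** * Finite independent draws and Hoeffding's lemma *)

Section Expectation.
Context (R : realType) (K : finType) (k0 : K) (p : K -> R).
Hypotheses (p0 : forall k, 0 <= p k) (p1 : \sum_k p k = 1).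

Lemma weighted_le (g g' : K -> R) : (forall k, g k <= g' k) ->
  \sum_k p k * g k <= \sum_k p k * g' k.
Proof. by move=> gg'; apply: ler_sum => k _; rewrite ler_wpM2l. Qed.

Lemma weighted_cst c : \sum_k p k * c = c.
Proof. by rewrite -mulr_suml p1 mul1r. Qed.

(** Replacing exp by its chord reduces [h] to a variable with the two values m and m + 1 and the
    same mean. *)
Lemma hoeffding (h : K -> R) (u : R) : (forall k k', h k <= h k' + 1) -> 0 <= u ->
  \sum_k p k * expR (u * h k) <= expR (u * (\sum_k p k * h k) + u ^+ 2 / 8).
Proof.
(* [k1] maximizes - h, so m is the minimum of [h], and q is the mean excess over it. *)
move=> hh u0; have [k1 mE] := fmaxP k0 (fun k => - h k).
pose m := h k1; pose q := \sum_k p k * (h k - m).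
have hm k : 0 <= h k - m <= 1.
  have := fmax_ge k0 (fun k => - h k) k; rewrite mE /m => H.
  by have H' := hh k k1; apply/andP; split; lra.
have qE : \sum_k p k * h k = m + q.
  rewrite -[m]weighted_cst -big_split/=; apply: eq_bigr => k _.
  by rewrite -mulrDr addrC subrK.
have q01 : 0 <= q <= 1.
  apply/andP; split.
    by apply: sumr_ge0 => k _; rewrite mulr_ge0//; case/andP: (hm k).
  rewrite -[leRHS]weighted_cst; apply: weighted_le => // k.
  by case/andP: (hm k).
apply: (@le_trans _ _ (\sum_k p k *
    (expR (u * m) * (1 - (h k - m) + (h k - m) * expR u)))).
  apply: weighted_le => // k.
  have -> : u * h k = u * m + u * (h k - m) by ring.
  by rewrite expRD ler_wpM2l ?expR_ge0// expR_chord.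
have -> : \sum_k p k * (expR (u * m) * (1 - (h k - m) + (h k - m) * expR u)) =
    expR (u * m) * (1 - q + q * expR u).
  have -> : 1 - q + q * expR u = \sum_k p k * (1 - (h k - m) + (h k - m) * expR u).
    rewrite -{1}[1](weighted_cst 1) /q mulr_suml -sumrB -big_split/=.
    by apply: eq_bigr => k _; ring.
  by rewrite mulr_sumr; apply: eq_bigr => k _; ring.
have := two_point_mgf q01 u0; rewrite qE => H.
have -> : u * (m + q) + u ^+ 2 / 8 = u * m + (q * u + u ^+ 2 / 8) by ring.
by rewrite [leRHS]expRD ler_wpM2l ?expR_ge0.
Qed.

(* Expectation of g over n independent draws from the weights p. *)
Fixpoint draw n (g : seq K -> R) : R :=
  if n is n'.+1 then \sum_k p k * draw n' (fun s => g (k :: s)) else g [::].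

Lemma draw_le n g g' : (forall s, size s = n -> g s <= g' s) ->
  draw n g <= draw n g'.
Proof.
elim: n g g' => [|n IH] g g' gg' /=; first exact: gg'.
by apply: weighted_le => k; apply: IH => s sn; apply: gg'; rewrite /= sn.
Qed.

Lemma draw_cst n c : draw n (fun=> c) = c.
Proof.
elim: n => [//|n IH] /=; rewrite -[RHS]weighted_cst.
by apply: eq_bigr => k _; rewrite IH.
Qed.

Lemma draw_sum (J : finType) (q : J -> R) n (g : J -> seq K -> R) :
  draw n (fun s => \sum_j q j * g j s) = \sum_j q j * draw n (g j).
Proof.
elim: n g => [//|n IH] g /=.
under eq_bigr do rewrite (IH (fun j s => g j (_ :: s))) mulr_sumr.
rewrite exchange_big/=; apply: eq_bigr => j _.
by rewrite mulr_sumr; apply: eq_bigr => k _; rewrite mulrCA.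
Qed.

Lemma drawZ n c g : draw n (fun s => c * g s) = c * draw n g.
Proof.
elim: n g => [//|n IH] g /=; rewrite mulr_sumr.
by apply: eq_bigr => k _; rewrite (IH (fun s => g (k :: s))) mulrCA.
Qed.

Lemma draw_half n (g g' : seq K -> R) :
  draw n (fun s => (g s + g' s) / 2) = (draw n g + draw n g') / 2.
Proof.
elim: n g g' => [//|n IH] g g' /=; rewrite -big_split/= mulr_suml.
apply: eq_bigr => k _.
by rewrite (IH (fun s => g (k :: s)) (fun s => g' (k :: s))); ring.
Qed.

Lemma draw_tuple n g :
  draw n g = \sum_(s : n.-tuple K) (\prod_(k <- s) p k) * g s.
Proof.
elim: n g => [|n IH] g /=.
  rewrite (big_pred1 [tuple]) ?big_nil ?mul1r// => s.
  by apply/esym/eqP/val_inj; case: s => -[].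
under eq_bigr => k _ do rewrite IH mulr_sumr.
rewrite pair_bigA/= [RHS](reindex (fun ks : K * n.-tuple K => cons_tuple ks.1 ks.2))/=.
  by apply: eq_bigr => -[k s] _ /=; rewrite big_cons mulrA.
exists (fun s => (thead s, [tuple of behead s])) => [[k s] _|s _] /=.
  by congr pair; apply: val_inj.
by rewrite [RHS]tuple_eta; apply: val_inj.
Qed.

End Expectation.

(** * Symmetrization and McDiarmid's inequality for finite weights *)

Section Symmetrization.
Context (R : realType) (I : finType) (i0 : I) (K : finType) (k0 : K) (p : K -> R).
Hypotheses (p0 : forall k, 0 <= p k) (p1 : \sum_k p k = 1).
Implicit Types (v L : I -> K -> R) (a b : I -> R).

(** The left fold feeds the first draw into the offset, which matches the recursions of [draw] and
    [rademacher]. *)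
Definition walk v (s : seq K) a : I -> R := foldl (fun a k i => a i + v i k) a s.

Lemma walkE v s a i : walk v s a i = a i + \sum_(k <- s) v i k.
Proof.
rewrite /walk; elim: s a => [|k s IH] a /=; first by rewrite big_nil addr0.
by rewrite IH big_cons addrA.
Qed.

(** McDiarmid's martingale argument: given the first draw, the induction hypothesis bounds the
    remaining moment by the conditional mean [h k], and Hoeffding's lemma applies to [h]. *)
Lemma draw_walk_mgf v n a u :
  (forall i k k', v i k <= v i k' + 1) -> 0 <= u ->
  draw p n (fun s => expR (u * fmax i0 (walk v s a)))
  <= expR (u * draw p n (fun s => fmax i0 (walk v s a)) + n%:R * (u ^+ 2 / 8)).
Proof.
move=> vv u0; elim: n a => [|n IH] a /=; first by rewrite mul0r addr0.
pose h k := draw p n (fun s => fmax i0 (walk v s (fun i => a i + v i k))).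
apply: (@le_trans _ _ (\sum_k p k * (expR (n%:R * (u ^+ 2 / 8)) * expR (u * h k)))).
  apply: weighted_le => // k; rewrite -expRD addrC.
  exact: (IH (fun i => a i + v i k)).
have -> : \sum_k p k * (expR (n%:R * (u ^+ 2 / 8)) * expR (u * h k)) =
   expR (n%:R * (u ^+ 2 / 8)) * \sum_k p k * expR (u * h k).
  by rewrite mulr_sumr; apply: eq_bigr => k _; rewrite mulrCA.
(* Changing the first draw moves every coordinate of the walk, hence their maximum, by at most 1. *)
have hh k k' : h k <= h k' + 1.
  rewrite -[X in _ + X](draw_cst p1 n) /h -[in leRHS]addrC.
  have dD g : 1 + draw p n g = draw p n (fun s => 1 + g s).
    elim: n g {IH h} => [//|m IHm] g /=.
    under [in RHS]eq_bigr do rewrite -(IHm (fun s => g (_ :: s))) mulrDr.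
    by rewrite big_split/= weighted_cst.
  rewrite draw_cst// dD; apply: draw_le => // s _; apply: fmax_le => i.
  apply: le_trans (lerD (lexx 1) (fmax_ge i0 _ i)).
  by rewrite !walkE; have := vv i k k'; lra.
apply: (@le_trans _ _ (expR (n%:R * (u ^+ 2 / 8)) *
    expR (u * (\sum_k p k * h k) + u ^+ 2 / 8))).
  by rewrite ler_wpM2l ?expR_ge0//; exact: hoeffding.
by rewrite -expRD ler_expR -[n.+1]addn1 natrD /h; lra.
Qed.

Definition jensen (psi : (I -> R) -> R) :=
  forall (J : finType) (q : J -> R) (x : J -> I -> R),
  (forall j, 0 <= q j) -> \sum_j q j = 1 ->
  psi (fun i => \sum_j q j * x j i) <= \sum_j q j * psi (x j).

Lemma jensen_midpoint psi a b : jensen psi ->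
  psi (fun i => (a i + b i) / 2) <= (psi a + psi b) / 2.
Proof.
move=> c.
have : psi (fun i => \sum_e 2^-1 * (if e then a else b) i)
    <= \sum_(e : bool) 2^-1 * psi (if e then a else b).
  by apply: c => [_|]; [rewrite invr_ge0 | rewrite big_bool/=; lra].
rewrite big_bool/= => H.
rewrite mulrC mulrDr; apply: le_trans H; rewrite le_eqVlt; apply/orP; left.
by apply/eqP; congr psi; apply/funext => i; rewrite big_bool/=; ring.
Qed.

Lemma rademacher_jensen (h : I -> K -> R) s : jensen (rademacher i0 h s).
Proof.
elim: s => [|k s IH] J q x q0 q1 /=.
  apply: fmax_le => i; apply: ler_sum => j _.
  by rewrite ler_wpM2l ?fmax_ge.
have E (e : I -> R) : (fun i => \sum_j q j * x j i + e i) =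
    (fun i => \sum_j q j * (x j i + e i)).
  apply/funext => i; under [RHS]eq_bigr do rewrite mulrDr.
  by rewrite big_split/= -mulr_suml q1 mul1r.
rewrite E (E (fun i => - h i k)) mulrC.
under [leRHS]eq_bigr do rewrite mulrA mulrC mulrDr.
rewrite -mulr_sumr ler_wpM2l ?invr_ge0// big_split/=.
by apply: lerD; exact: IH.
Qed.

Lemma draw_jensen n (psi : seq K -> (I -> R) -> R) : (forall s, jensen (psi s)) ->
  jensen (fun a => draw p n (fun s => psi s a)).
Proof.
move=> c J q x q0 q1; rewrite -draw_sum.
by apply: draw_le => // s _; exact: c.
Qed.

(* Jensen replaces the mean by an independent copy k', and a + L k' - L k is the
   midpoint of a + 2 L k' and a - 2 L k. *)
Lemma symmetrize_step psi L a : jensen psi ->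
  \sum_k p k * psi (fun i => a i + (\sum_k' p k' * L i k' - L i k))
  <= \sum_k p k * ((psi (fun i => a i + 2 * L i k) + psi (fun i => a i - 2 * L i k)) / 2).
Proof.
move=> c.
pose A k := psi (fun i => a i + 2 * L i k); pose B k := psi (fun i => a i - 2 * L i k).
apply: (@le_trans _ _ (\sum_k p k * (\sum_k' p k' * ((A k' + B k) / 2)))).
  apply: weighted_le => // k.
  apply: (@le_trans _ _ (\sum_k' p k' * psi (fun i => a i + (L i k' - L i k)))).
    rewrite (_ : (fun i => _) = (fun i => \sum_k' p k' * (a i + (L i k' - L i k)))).
      exact: c.
    apply/funext => i; under [RHS]eq_bigr do rewrite !mulrDr.
    by rewrite !big_split/= !weighted_cst.
  apply: weighted_le => // k'; apply: le_trans (jensen_midpoint _ _ c).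
  by rewrite le_eqVlt; apply/orP; left; apply/eqP; congr psi; apply/funext => i; field.
rewrite le_eqVlt; apply/orP; left; apply/eqP.
under eq_bigr => k _.
  under eq_bigr => k' _ do rewrite mulrDl mulrDr.
  rewrite big_split/= weighted_cst// mulrDr; over.
rewrite big_split/= weighted_cst// -big_split/=.
by apply: eq_bigr => k _; rewrite /A /B; ring.
Qed.

(** Draws are symmetrized from the last to the first: once the later ones are, what remains is a
    functional of the offset, convex as an average of maxima of affine maps, to which
    [symmetrize_step] applies. *)
Lemma symmetrization L n a :
  draw p n (fun s => fmax i0 (walk (fun i k => \sum_k' p k' * L i k' - L i k) s a))
  <= draw p n (fun s => rademacher i0 (fun i k => 2 * L i k) s a).
Proof.
elim: n a => [//|n IH] a.
set rhs := leRHS.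
pose psi a := draw p n (fun s => rademacher i0 (fun i k => 2 * L i k) s a).
have -> : rhs = \sum_k p k *
    ((psi (fun i => a i + 2 * L i k) + psi (fun i => a i - 2 * L i k)) / 2).
  by rewrite /rhs /=; apply: eq_bigr => k _; rewrite draw_half.
apply: le_trans (symmetrize_step _ _ _); last first.
  by apply: draw_jensen => s; exact: rademacher_jensen.
by apply: weighted_le => // k; exact: (IH (fun i => a i + _)).
Qed.

(** Chernoff's bound: the indicator is at most exp (u (max - x)). The rate [u] stays free, to be
    optimized against the sample size. *)
Lemma deviation_tail L n (x B u : R) :
  (forall i k, 0 <= L i k <= 1) -> 0 <= u ->
  (forall s, size s = n -> rademacher i0 (fun i k => 2 * L i k) s (fun=> 0) <= B) ->
  draw p n (fun s =>
    (x <= fmax i0 (walk (fun i k => \sum_k' p k' * L i k' - L i k) s (fun=> 0)))%R%:R)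
  <= expR (u * (B - x) + n%:R * (u ^+ 2 / 8)).
Proof.
move=> L01 u0 radB; pose v i k := \sum_k' p k' * L i k' - L i k.
apply: (@le_trans _ _ (draw p n (fun s => expR (- (u * x)) *
    expR (u * fmax i0 (walk v s (fun=> 0)))))).
  apply: draw_le => // s _; rewrite -expRD.
  case: (leP x _) => [xs|_] /=; last exact: expR_ge0.
  by rewrite -expR0 ler_expR addrC subr_ge0 ler_wpM2l.
rewrite drawZ; set E := draw p n _.
have EB : draw p n (fun s => fmax i0 (walk v s (fun=> 0))) <= B.
  apply: le_trans (symmetrization _ _ _) _.
  by rewrite -[leRHS](draw_cst p1 n); exact: draw_le.
apply: (@le_trans _ _ (expR (- (u * x)) * expR (u * B + n%:R * (u ^+ 2 / 8)))).
  rewrite ler_wpM2l ?expR_ge0//; apply: le_trans (draw_walk_mgf _ _ _ u0) _.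
    move=> i k k'; rewrite /v; have := L01 i k; have := L01 i k'; lra.
  by rewrite ler_expR lerD2r ler_wpM2l.
by rewrite -expRD ler_expR; lra.
Qed.

End Symmetrization.

(** * Euclidean geometry and linear classes *)

Section EuclideanNorm.
Context (R : realType).

(** Lagrange's identity: the double sum of squares is twice the difference of the two sides. *)
Lemma cauchy_schwarz (J : finType) (a b : J -> R) :
  (\sum_i a i * b i) ^+ 2 <= (\sum_i a i ^+ 2) * (\sum_i b i ^+ 2).
Proof.
have : 0 <= \sum_i \sum_j (a i * b j - a j * b i) ^+ 2.
  by apply: sumr_ge0 => i _; apply: sumr_ge0 => j _; exact: sqr_ge0.
have -> : \sum_i \sum_j (a i * b j - a j * b i) ^+ 2 =
    2 * ((\sum_i a i ^+ 2) * (\sum_i b i ^+ 2) - (\sum_i a i * b i) ^+ 2).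
  rewrite expr2 !big_distrlr/= mulrBr.
  transitivity (\sum_i \sum_j (a i ^+ 2 * b j ^+ 2) +
      \sum_i \sum_j (a j ^+ 2 * b i ^+ 2) - 2 * \sum_i \sum_j a i * b i * (a j * b j)).
    rewrite mulr_sumr -big_split -sumrB/=; apply: eq_bigr => i _.
    rewrite mulr_sumr -big_split -sumrB/=; apply: eq_bigr => j _; ring.
  rewrite [X in _ + X - _]exchange_big/=; ring.
lra.
Qed.

Lemma euclidean_norm_ge0 n (v : 'cV[R]_n) : 0 <= euclidean_norm v.
Proof. exact: sqrtr_ge0. Qed.

Lemma sqr_euclidean_norm n (v : 'cV[R]_n) :
  euclidean_norm v ^+ 2 = \sum_(i < n) v i 0 ^+ 2.
Proof. by rewrite sqr_sqrtr// sumr_ge0// => i _; exact: sqr_ge0. Qed.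

Lemma ler_inner_norm n (v w : 'cV[R]_n) :
  `|(v^T *m w) 0 0| <= euclidean_norm v * euclidean_norm w.
Proof.
rewrite -(@ler_pXn2r _ 2)// ?nnegrE ?mulr_ge0 ?euclidean_norm_ge0//.
rewrite real_normK ?num_real// exprMn !sqr_euclidean_norm mxE.
under eq_bigr do rewrite mxE; exact: cauchy_schwarz.
Qed.

Lemma parallelogram n (v w : 'cV[R]_n) :
  euclidean_norm (v + w) ^+ 2 + euclidean_norm (v - w) ^+ 2 =
  2 * (euclidean_norm v ^+ 2 + euclidean_norm w ^+ 2).
Proof.
rewrite !sqr_euclidean_norm -!big_split/= mulr_sumr.
by apply: eq_bigr => i _; rewrite !mxE; ring.
Qed.

Lemma sqrtr_midpoint (x y : R) : 0 <= x -> 0 <= y ->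
  Num.sqrt x + Num.sqrt y <= 2 * Num.sqrt ((x + y) / 2).
Proof.
move=> x0 y0.
rewrite -(@ler_pXn2r _ 2)// ?nnegrE ?mulr_ge0 ?addr_ge0 ?sqrtr_ge0//.
rewrite exprMn sqr_sqrtr ?divr_ge0 ?addr_ge0// sqrrD !sqr_sqrtr//.
have := sqr_ge0 (Num.sqrt x - Num.sqrt y); rewrite sqrrB !sqr_sqrtr//; lra.
Qed.

(** Here [w] is the signed sum so far. By the parallelogram law its squared norm grows on average by
    that of [a z], and concavity of the square root passes the average under the root;
    Cauchy-Schwarz settles the empty sample. *)
Lemma rademacher_linear (I : finType) (i0 : I) (S : Type) n
    (b : I -> 'cV[R]_n) (a : S -> 'cV[R]_n) (t l : R) (s : seq S) (w : 'cV[R]_n) :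
  0 <= t -> (forall z, euclidean_norm (a z) <= t) ->
  (forall i, euclidean_norm (b i) <= l) ->
  rademacher i0 (fun i z => ((a z)^T *m b i) 0 0) s (fun i => (w^T *m b i) 0 0)
  <= l * Num.sqrt (euclidean_norm w ^+ 2 + (size s)%:R * t ^+ 2).
Proof.
move=> t0 at_ bl; have l0 : 0 <= l by apply: le_trans (bl i0); exact: sqrtr_ge0.
elim: s w => [|z s IH] w /=.
  apply: fmax_le => i; rewrite mul0r addr0 sqrtr_sqr ger0_norm ?euclidean_norm_ge0//.
  apply: le_trans (ler_norm _) _; apply: le_trans (ler_inner_norm _ _) _.
  by rewrite mulrC ler_wpM2r ?euclidean_norm_ge0.
have := IH (w + a z); have := IH (w - a z).
have -> : (fun i => ((w + a z)^T *m b i) 0 0) =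
    (fun i => (w^T *m b i) 0 0 + ((a z)^T *m b i) 0 0).
  by apply/funext => i; rewrite linearD/= mulmxDl mxE.
have -> : (fun i => ((w - a z)^T *m b i) 0 0) =
    (fun i => (w^T *m b i) 0 0 - ((a z)^T *m b i) 0 0).
  by apply/funext => i; rewrite linearB/= mulmxBl !mxE.
set A := rademacher _ _ _ _; set B := rademacher _ _ _ _.
set x := _ ^+ 2 + _; set y := _ ^+ 2 + _ => Ax By.
have Q0 (e : R) m : 0 <= e ^+ 2 + m%:R * t ^+ 2.
  by apply: addr_ge0; [exact: sqr_ge0 | apply: mulr_ge0 => //; exact: sqr_ge0].
have x0 : 0 <= x by exact: Q0.
have y0 : 0 <= y by exact: Q0.
have le_xy : Num.sqrt ((x + y) / 2) <=
    Num.sqrt (euclidean_norm w ^+ 2 + (size s).+1%:R * t ^+ 2).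
  rewrite ler_sqrt; last exact: Q0.
  have -> : (x + y) / 2 = euclidean_norm w ^+ 2 + euclidean_norm (a z) ^+ 2
      + (size s)%:R * t ^+ 2.
    have := parallelogram w (a z); rewrite /x /y => H.
    by rewrite addrACA addrC [X in _ + X]addrC H; field.
  rewrite -[(size s).+1]addn1 natrD mulrDl mul1r -addrA lerD2l addrC lerD2l.
  by rewrite ler_pXn2r// nnegrE ?euclidean_norm_ge0.
have := ler_wpM2l l0 (sqrtr_midpoint x0 y0); have := ler_wpM2l l0 le_xy.
lra.
Qed.

Lemma euclidean_norm_eq0 n (v : 'cV[R]_n) : euclidean_norm v <= 0 -> v = 0.
Proof.
move=> v0; have {}v0 : euclidean_norm v = 0.
  by apply/le_anti; rewrite v0 euclidean_norm_ge0.
have : \sum_(i < n) v i 0 ^+ 2 = 0 by rewrite -sqr_euclidean_norm v0 expr0n.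
move/psumr_eq0P => H; apply/matrixP => i j; rewrite mxE ord1.
by apply/eqP; rewrite -sqrf_eq0; apply/eqP; apply: H => // k _; exact: sqr_ge0.
Qed.

End EuclideanNorm.

Section LinearPart.
Context (R : realType) (X T : Type) (F : composition R X T).

Lemma tau_ge0 k : T -> (0 <= tau F k)%E.
Proof.
move=> t; apply: (@le_trans _ _ (euclidean_norm (psi F k t))%:E).
  by rewrite lee_fin euclidean_norm_ge0.
by apply: ereal_sup_ubound; exists t.
Qed.

Lemma Lambda_ge0 k : X -> (0 <= Lambda F k)%E.
Proof.
move=> x; apply: (@le_trans _ _ (euclidean_norm (phi F k x))%:E).
  by rewrite lee_fin euclidean_norm_ge0.
by apply: ereal_sup_ubound; exists x.
Qed.

Lemma le_tau k t : ((euclidean_norm (psi F k t))%:E <= tau F k)%E.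
Proof. by apply: ereal_sup_ubound; exists t. Qed.

Lemma le_Lambda k x : ((euclidean_norm (phi F k x))%:E <= Lambda F k)%E.
Proof. by apply: ereal_sup_ubound; exists x. Qed.

(** A finite product of suprema does not make both factors finite, since 0 * +oo = 0; but if one
    supremum is 0, the linear part vanishes identically. *)
Variant bounded_part_spec k c : Prop :=
| BoundedPart t l of 0 <= t & 0 <= l & c = t * l
    & (forall z, euclidean_norm (psi F k z) <= t)
    & (forall x, euclidean_norm (phi F k x) <= l)
| ZeroPart of c = 0 & (forall x z, linear_part F k x z = 0).

Lemma bounded_partP k c : T -> X -> (tau F k * Lambda F k)%E = c%:E ->
  bounded_part_spec k c.
Proof.
move=> t0 x0; have := tau_ge0 k t0; have := Lambda_ge0 k x0.
have := le_tau k; have := le_Lambda k.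
case: (tau F k) => [t| |//]; case: (Lambda F k) => [l| |//] hl ht l0 t0' E.
- by move: E => [<-]; exact: (BoundedPart t0' l0).
- have [t1|t1] := eqVneq t 0.
    apply: ZeroPart; first by move: E; rewrite t1 mul0e => -[].
    move=> x z; rewrite /linear_part (@euclidean_norm_eq0 _ _ (psi F k z)).
      by rewrite trmx0 mul0mx mxE.
    by have := ht z; rewrite lee_fin t1.
  by move: E; rewrite gt0_muley// lte_fin lt_neqAle eq_sym t1.
- have [l1|l1] := eqVneq l 0.
    apply: ZeroPart; first by move: E; rewrite l1 mule0 => -[].
    move=> x z; rewrite /linear_part (@euclidean_norm_eq0 _ _ (phi F k x)).
      by rewrite mulmx0 mxE.
    by have := hl x; rewrite lee_fin l1.
  by move: E; rewrite gt0_mulye// lte_fin lt_neqAle eq_sym l1.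
- by move: E; rewrite mulyy.
Qed.

Lemma rademacher_linear_part (I : finType) (i0 : I) (x : I -> X) (t0 : T) k c s :
  (tau F k * Lambda F k)%E = c%:E ->
  rademacher i0 (fun i => linear_part F k (x i)) s (fun=> 0)
  <= c * Num.sqrt (size s)%:R.
Proof.
move=> /(bounded_partP t0 (x i0))[t l t_ge0 l_ge0 -> ht hl|-> h0]; last first.
  have -> : (fun i => linear_part F k (x i)) = (fun _ _ => 0).
    by apply/funext => i; apply/funext => z.
  by rewrite mul0r rademacher_const.
have := @rademacher_linear R I i0 T _ (fun i => phi F k (x i)) (psi F k) t l s 0 t_ge0 ht.
move=> /(_ (fun i => hl (x i))).
have -> : (fun i => ((0 : 'cV_(Defs.dim F k))^T *m phi F k (x i)) 0 0) = (fun=> 0).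
  by apply/funext => i; rewrite trmx0 mul0mx mxE.
move=> /le_trans; apply.
rewrite (_ : euclidean_norm 0 = 0); last first.
  by rewrite /euclidean_norm big1 ?sqrtr0// => i _; rewrite mxE expr0n.
rewrite expr0n add0r sqrtrM// sqrtr_sqr ger0_norm//; lra.
Qed.

Lemma rademacher_composition_bound (I : finType) (i0 : I) (x : I -> X) (t0 : T)
    C c s : nonexpansive_composition F C -> (1 <= C)%N ->
  (forall k, (1 <= k <= C)%N -> (tau F k * Lambda F k)%E = (c k)%:E) ->
  rademacher i0 (fun i => partial_composition F C (x i)) s (fun=> 0)
  <= (\sum_(1 <= k < C.+1) c k) * Num.sqrt (size s)%:R.
Proof.
move=> hF hC hc; apply: le_trans (rademacher_composition _ _ _ hF hC) _.
rewrite mulr_suml big_nat_cond [leRHS]big_nat_cond; apply: ler_sum => k.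
by rewrite andbT ltnS => /hc; exact: rademacher_linear_part.
Qed.

End LinearPart.

(** * Reduction of theta to finitely many cells *)

Section Partition.
Context d (T : measurableType d) (R : realType) (P : probability T R).

Lemma measure_partition (K : finType) (c : T -> K) (A : set T) :
  (forall k, measurable (c @^-1` [set k])) -> measurable A ->
  P A = (\sum_k P (A `&` c @^-1` [set k]))%E.
Proof.
move=> mc mA.
rewrite (fsbig_seq _ (fun k => P (A `&` c @^-1` [set k]))) ?index_enum_uniq//.
rewrite -measure_fin_bigcup//.
- congr (P _); apply/seteqP; split=> [t At|t [k _ []]//].
  by exists (c t) => //=; exact: mem_index_enum.
- by move=> k k' _ _ [t [[_ /= <-] [_ /= <-]]].
- by move=> k _; exact: measurableI.
Qed.

Lemma sum_cell_measure (K : finType) (c : T -> K) :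
  (forall k, measurable (c @^-1` [set k])) ->
  \sum_k fine (P (c @^-1` [set k])) = 1.
Proof.
move=> mc; apply: EFin_inj; rewrite -sumEFin -(@probability_setT _ _ _ P).
rewrite (measure_partition mc measurableT); apply: eq_bigr => k _.
by rewrite setTI fineK// fin_num_measure.
Qed.

Section Cells.
Context (I : finType) (l : I -> T -> R) (n : nat).

(** The levels are 1/n, ..., n/n; level 0 is left out, as nonnegative losses always reach it. *)
Definition cell (t : T) : {ffun I * 'I_n -> bool} :=
  [ffun ij : I * 'I_n => (ij.2.+1)%:R / n%:R <= l ij.1 t].

Lemma measurable_cell k : (forall i, measurable_fun setT (l i)) ->
  measurable (cell @^-1` [set k]).
Proof.
move=> ml.
have -> : cell @^-1` [set k] = \bigcap_(ij in [set: I * 'I_n])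
    [set t | ((ij.2.+1)%:R / n%:R <= l ij.1 t) = k ij].
  apply/seteqP; split=> [t /= <- ij _|t H] /=; first by rewrite ffunE.
  by apply/ffunP => ij; rewrite ffunE; exact: H.
apply: fin_bigcap_measurable => // ij _.
rewrite -[X in measurable X]setTI.
have /(_ measurableT [set k ij]) := measurable_fun_ler
  (@measurable_cst _ _ T R setT ((ij.2.+1)%:R / n%:R)) (ml ij.1).
exact.
Qed.

Lemma cell_close i t t' : (0 < n)%N -> (forall i t, 0 <= l i t <= 1) ->
  cell t = cell t' -> l i t <= l i t' + n%:R^-1.
Proof.
move=> n0 l01 tt'; have /andP[t0 t1] := l01 i t; have /andP[t'0 _] := l01 i t'.
have n0' : 0 < n%:R :> R by rewrite ltr0n.
have nt0 : 0 <= n%:R * l i t by rewrite mulr_ge0.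
have /andP[] := truncn_itv nt0.
(* If the integer part is 0, the loss is below 1/n. If it is a + 1, index [a] stands for the level
   (a + 1)/n, which [t] and hence [t'] reaches. *)
case E : (Num.truncn (n%:R * l i t)) => [|a] aL aU.
  have : l i t <= n%:R^-1 by rewrite -[leRHS]mulr1 ler_pdivlMl// ltW.
  lra.
have an : (a < n)%N.
  rewrite -(ltr_nat R) (@lt_le_trans _ _ a.+1%:R) ?ltr_nat//.
  by apply: le_trans aL _; rewrite ler_piMr// ltW.
have : cell t (i, Ordinal an) by rewrite ffunE/= ler_pdivrMr// mulrC.
rewrite tt' ffunE/= ler_pdivrMr// => aL'.
have : n%:R * l i t <= n%:R * (l i t' + n%:R^-1).
  rewrite mulrDr divff ?gt_eqF// (le_trans (ltW aU))//.
  by rewrite -[a.+2]addn1 natrD lerD2r mulrC.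
by rewrite ler_pM2l.
Qed.

End Cells.

End Partition.

Section Sample.
Context d d' (W : measurableType d) (T : measurableType d') (R : realType).
Context (P : probability T R) (Q : probability W R) (N : nat).
Context (theta : 'I_N -> {RV Q >-> T}) (htheta : independent_copies P theta).

(** [A] need not be a union of cells: the bad code sequences cover it, and independence factors the
    probability of each into the weights that [draw] uses. *)
Lemma sample_distribution (K : finType) (c : T -> K) (bad : pred (seq K)) (A : set W) :
  (forall k, measurable (c @^-1` [set k])) -> measurable A ->
  (forall w, A w -> bad [tuple c (theta j w) | j < N]) ->
  (Q A <= (draw (fun k => fine (P (c @^-1` [set k]))) N (fun s => (bad s)%:R))%:E)%E.
Proof.
move=> mc mA hA; have [ind dist] := htheta.
pose c' w : N.-tuple K := [tuple c (theta j w) | j < N].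
have c'E (s : N.-tuple K) : c' @^-1` [set s] =
    \bigcap_(j in [set` [set: 'I_N]%SET]) (theta j @^-1` (c @^-1` [set tnth s j])).
  apply/seteqP; split=> [w /= <- j _|w H] /=; first by rewrite tnth_mktuple.
  by apply: eq_from_tnth => j; rewrite tnth_mktuple; apply: H; rewrite /= inE.
have mtheta j k : measurable (theta j @^-1` (c @^-1` [set k])).
  by rewrite -[X in measurable X]setTI; exact: measurable_funP.
have mc' s : measurable (c' @^-1` [set s]).
  by rewrite c'E; apply: fin_bigcap_measurable => // j _; exact: mtheta.
rewrite (measure_partition Q mc' mA) draw_tuple -sumEFin.
apply: lee_sum => s _; case: (boolP (bad s)) => [bs|nbs]; last first.
  rewrite mulr0 (_ : _ `&` _ = set0) ?measure0//.
  by apply/seteqP; split=> // w [/hA + /= E]; rewrite -/(c' w) E (negbTE nbs).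
rewrite mulr1; apply: (@le_trans _ _ (Q (c' @^-1` [set s]))).
  by apply: le_measure; rewrite ?inE//; exact: measurableI.
rewrite c'E (ind _ (fun j => c @^-1` [set tnth s j])); last by move=> j; exact: mc.
rewrite big_tuple -prodEFin le_eqVlt; apply/orP; left; apply/eqP.
apply: eq_big => [j|j _]; first by rewrite inE.
rewrite fineK ?fin_num_measure//.
exact: (dist j (c @^-1` [set tnth s j]) (mc _)).
Qed.

Section Deviation.
Context (I : finType) (i0 : I) (l : I -> T -> R) (U : I -> set T) (z : I -> R).
Hypotheses (ml : forall i, measurable_fun setT (l i))
  (l01 : forall i t, 0 <= l i t <= 1) (mU : forall i, measurable (U i))
  (z0 : forall i, 0 <= z i) (lU : forall i t, U i t -> 1 - z i <= l i t).

(* The slack eta absorbs the error of replacing theta by its cell; U i stands for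
   an event on which the i-th loss is at least 1 - z i. *)
Lemma sample_deviation (B u x eta : R) (A : set W) :
  (forall s, size s = N -> rademacher i0 (fun i t => 2 * l i t) s (fun=> 0) <= B) ->
  0 <= u -> 0 < eta -> measurable A ->
  (forall w, A w -> exists i, x + N%:R * eta <=
      N%:R * (fine (P (U i)) - z i) - \sum_j l i (theta j w)) ->
  (Q A <= (expR (u * (B - x) + N%:R * (u ^+ 2 / 8)))%:E)%E.
Proof.
move=> radB u0 eta0 mA hA.
(* A cell costs 1/n twice, once in the mean and once in the empirical sum. *)
pose n := (Num.truncn (2 / eta)).+1.
have n_gt0 : 0 < n%:R :> R by rewrite ltr0n.
have n_eta : 2 * n%:R^-1 <= eta.
  rewrite ler_pdivrMr// mulrC -ler_pdivrMr// ltW//.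
  exact: truncnS_gt.
pose c := @cell _ T R I l n.
have mc k : measurable (c @^-1` [set k]) by exact: measurable_cell.
have [t0 _] : exists t : T, True.
  apply/not_existsP => noT.
  have : P setT = 0%E by rewrite (_ : setT = set0) ?measure0//; apply/seteqP; split=> // t.
  by rewrite probability_setT => -[] /eqP; rewrite oner_eq0.
(* Empty cells receive the arbitrary value [t0]; their weight is 0. *)
pose rep k := if pselect (exists t, c t = k) is left e then projT1 (cid e) else t0.
have repK t : c (rep (c t)) = c t.
  rewrite /rep; case: pselect => [e|]; last by case; exists t.
  by case: (cid e).
pose p k := fine (P (c @^-1` [set k])).
have p0 k : 0 <= p k by rewrite fine_ge0.
have p1 : \sum_k p k = 1 by exact: sum_cell_measure.
pose L i k := l i (rep k).
pose r : R := n%:R^-1.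
have r0 : 0 <= r by rewrite invr_ge0 ltW.
have Ll i t : L i (c t) <= l i t + r.
  by apply: cell_close => //; exact: repK.
have lL i t : l i t <= L i (c t) + r.
  by apply: cell_close => //; rewrite repK.
(* On a cell that meets [U i], L is at least 1 - z i - r; the other cells carry none of [U i]. *)
have PU i : fine (P (U i)) <= \sum_k p k * L i k + (z i + r).
  have -> : \sum_k p k * L i k + (z i + r) = \sum_k p k * (L i k + (z i + r)).
    under [RHS]eq_bigr do rewrite mulrDr.
    by rewrite big_split/= weighted_cst.
  rewrite -lee_fin fineK ?fin_num_measure// (measure_partition P mc (mU i)) -sumEFin.
  apply: lee_sum => k _.
  have L0 : 0 <= L i k + (z i + r).
    by case/andP: (l01 i (rep k)) => ? _; rewrite !addr_ge0.
  have [->|/set0P[t [Ut ctk]]] := eqVneq (U i `&` c @^-1` [set k]) set0.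
    by rewrite measure0 lee_fin mulr_ge0.
  apply: (@le_trans _ _ (p k)%:E).
    rewrite /p fineK ?fin_num_measure//.
    by apply: le_measure; rewrite ?inE//; exact: measurableI.
  rewrite lee_fin ler_peMr//; move: (lL i t) (lU Ut); rewrite ctk; lra.
apply: le_trans (sample_distribution
  (bad := fun s => x <= fmax i0 (walk (fun i k => \sum_k' p k' * L i k' - L i k) s
                                   (fun=> 0))) mc mA _) _.
  move=> w /hA[i hi].
  apply: (le_trans _ (fmax_ge i0 _ i)); rewrite walkE add0r big_tuple.
  under eq_bigr do rewrite tnth_mktuple.
  rewrite sumrB sumr_const card_ord -mulr_natl.
  have H1 : \sum_(j < N) L i (c (theta j w)) <= \sum_j l i (theta j w) + N%:R * r.
    have -> : N%:R * r = \sum_(j < N) r by rewrite sumr_const card_ord mulr_natl.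
    by rewrite -big_split/=; apply: ler_sum => j _; exact: Ll.
  have H2 : N%:R * fine (P (U i)) <= N%:R * (\sum_k p k * L i k + (z i + r)).
    by rewrite ler_wpM2l.
  have H3 : N%:R * (2 * r) <= N%:R * eta by rewrite ler_wpM2l.
  lra.
rewrite lee_fin; have k0 := c t0; apply: deviation_tail => //.
  by move=> i k; exact: l01.
move=> s sN.
(* Through representatives, a sequence of codes is a genuine sample of length N, so the bound for
   every fixed sample applies. *)
rewrite (_ : rademacher _ _ _ _ =
  rademacher i0 (fun i t => 2 * l i t) (map rep s) (fun=> 0)).
  by apply: radB; rewrite size_map.
rewrite {sN}; elim: s (fun=> 0) => [//|k s IH] a /=.
by rewrite !IH.
Qed.

End Deviation.
End Sample.

Lemma ler_dist_combine (R : realType) o (a a' b b' : R) :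
  `|combine o a b - combine o a' b'| <= `|a - a'| + `|b - b'|.
Proof.
have := ler_norm (a - a'); have := ler_norm (a' - a); rewrite (distrC a').
have := ler_norm (b - b'); have := ler_norm (b' - b); rewrite (distrC b').
move=> h1 h2 h3 h4; rewrite ler_norml; case: o => /=.
- by case: (leP a b) => h5; case: (leP a' b') => h6; apply/andP; split; lra.
- by case: (leP a b) => h5; case: (leP a' b') => h6; apply/andP; split; lra.
- by apply/andP; split; lra.
- by apply/andP; split; lra.
Qed.

(** * Clipping and regularity of the margin loss *)

Section MarginLoss.
Context (R : realType) (gamma : R) (gamma0 : 0 < gamma).
Local Notation ml := (margin_loss gamma).

Lemma margin_lossE v : ml v = Num.max 0 (Num.min 1 (1 + v / gamma)).
Proof.
rewrite /margin_loss; case: ifPn => [v0|].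
  by rewrite min_l ?max_r// lerDl divr_ge0// ltW.
rewrite -ltNge => v0.
have v1 : v / gamma < 0 by rewrite pmulr_llt0 ?invr_gt0.
rewrite min_r; last by lra.
case: ifPn => [gv|].
  have : -1 < v / gamma by rewrite ltr_pdivlMr// mulN1r.
  by move=> ?; rewrite max_r//; lra.
rewrite -leNgt => vg.
have : v / gamma <= -1 by rewrite ler_pdivrMr// mulN1r.
by move=> ?; rewrite max_l//; lra.
Qed.

Lemma margin_loss01 v : 0 <= ml v <= 1.
Proof. by rewrite margin_lossE le_max lexx ge_max ge_min lexx ler01. Qed.

Lemma margin_loss_ge v : Num.min 1 (1 + v / gamma) <= ml v.
Proof. by rewrite margin_lossE le_max lexx orbT. Qed.

Lemma margin_loss_near1 v e : 0 <= e -> - e < v -> 1 - e / gamma <= ml v.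
Proof.
move=> e0 ev; apply: le_trans (margin_loss_ge v).
have : - e / gamma <= v / gamma by rewrite ler_pM2r ?invr_gt0// ltW.
have : 0 <= e / gamma by rewrite divr_ge0// ltW.
by rewrite le_min => ? ?; apply/andP; split; lra.
Qed.

Lemma margin_loss_eq0 v : v <= - gamma -> ml v = 0.
Proof.
by move=> vg; rewrite /margin_loss leNgt (le_lt_trans vg) ?oppr_lt0//= ltNge vg.
Qed.

Lemma margin_loss_lipschitz v v' : `|ml v - ml v'| <= `|v - v'| / gamma.
Proof.
have -> : `|v - v'| / gamma = `|v / gamma - v' / gamma|.
  by rewrite -mulrBl normrM (@gtr0_norm _ gamma^-1) ?invr_gt0.
rewrite !margin_lossE.
apply: le_trans (ler_dist_combine CombMax _ _ _ _) _; rewrite subrr normr0 add0r.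
apply: le_trans (ler_dist_combine CombMin _ _ _ _) _; rewrite subrr normr0 add0r.
by rewrite opprD addrACA subrr add0r.
Qed.

Lemma measurable_margin_loss d (T : measurableType d) (g : T -> R) :
  measurable_fun setT g -> measurable_fun setT (fun t => ml (g t)).
Proof.
move=> mg; rewrite (_ : (fun t => _) =
    (cst 0 \max (cst 1 \min (cst 1 \+ (g \* cst gamma^-1))))); last first.
  by apply/funext => t /=; rewrite margin_lossE.
apply: measurable_maxr => //; apply: measurable_minr => //.
by apply: measurable_funD => //; exact: measurable_funM.
Qed.

End MarginLoss.

(** * Reduction of [X] to countably many points *)

Section Codes.
Context (R : realType) (X T : Type).

(* A uniform-norm version of separability: countably many classes of points x on
   each of which f x varies by at most e, uniformly in t. *)
Definition countably_coded (f : X -> T -> R) := forall e : R, 0 < e ->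
  exists c : X -> nat, forall x y t, c x = c y -> `|f x t - f y t| <= e.

Lemma countably_coded_contraction f g : countably_coded f ->
  (forall x y t, `|g x t - g y t| <= `|f x t - f y t|) -> countably_coded g.
Proof.
move=> cf gf e e0; have [c hc] := cf e e0; exists c => x y t cxy.
exact: le_trans (gf x y t) (hc x y t cxy).
Qed.

Lemma countably_coded_combine o f g : countably_coded f -> countably_coded g ->
  countably_coded (fun x t => combine o (f x t) (g x t)).
Proof.
move=> cf cg e e0; have e2 : 0 < e / 2 by rewrite divr_gt0.
have [c hc] := cf _ e2; have [c' hc'] := cg _ e2.
exists (fun x => pickle (c x, c' x)) => x y t /(pcan_inj pickleK)[cxy cxy'].
apply: le_trans (ler_dist_combine _ _ _ _ _) _.
by have := hc x y t cxy; have := hc' x y t cxy'; lra.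
Qed.

Lemma countably_coded_inner n (a : T -> 'cV[R]_n) (b : X -> 'cV[R]_n) (m : R) :
  0 <= m -> (forall t, euclidean_norm (a t) <= m) ->
  countably_coded (fun x t => ((a t)^T *m b x) 0 0).
Proof.
move=> m0 am e e0.
(* Coordinates agreeing up to 1/k change the inner product by at most n m / k, which is at most e;
   the 1 keeps k positive when n m = 0. Integer vectors are countable, so [b] may be unbounded. *)
pose k : R := (n%:R * m + 1) / e.
have nm0 : 0 <= n%:R * m by rewrite mulr_ge0.
have k0 : 0 < k by rewrite divr_gt0//; lra.
exists (fun x => pickle [ffun j => Num.floor (k * b x j 0)]) => x y t.
move=> /(pcan_inj pickleK)/ffunP cxy.
have bxy j : `|b x j 0 - b y j 0| <= k^-1.
  have := cxy j; rewrite !ffunE => E.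
  have := floor_itv (k * b x j 0); have := floor_itv (k * b y j 0).
  rewrite E intrD => /andP[h1 h2] /andP[h3 h4].
  rewrite -(@ler_pM2l _ k)// divff ?gt_eqF// -[X in X * _](gtr0_norm k0) -normrM.
  by rewrite ler_norml; apply/andP; split; lra.
rewrite !mxE -sumrB; apply: le_trans (ler_norm_sum _ _ _) _.
apply: (@le_trans _ _ (\sum_(j < n) m * k^-1)).
  apply: ler_sum => j _; rewrite !mxE -mulrBr normrM ler_pM//.
  apply: le_trans (am t); rewrite -sqrtr_sqr ler_sqrt.
    by rewrite (bigD1 j)//= lerDl sumr_ge0// => i _; exact: sqr_ge0.
  by rewrite sumr_ge0// => i _; exact: sqr_ge0.
rewrite sumr_const card_ord -mulr_natl mulrA ler_pdivrMr//.
by rewrite /k mulrCA divff ?gt_eqF// mulr1; lra.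
Qed.

Context (F : composition R X T).

Lemma countably_coded_composition C (t0 : T) (c : nat -> R) :
  nonexpansive_composition F C -> (1 <= C)%N ->
  (forall k, (1 <= k <= C)%N -> (tau F k * Lambda F k)%E = (c k)%:E) ->
  countably_coded (partial_composition F C).
Proof.
move=> [lo ll] C1 hc.
have clin k : (1 <= k <= C)%N ->
    countably_coded (fun x t => outer F k (component F k x t)).
  move=> kC; apply: (@countably_coded_contraction (linear_part F k)).
    have [[x0]|noX] := pselect (inhabited X); last first.
      by move=> e e0; exists (fun=> 0%N) => x; case: noX; exists.
    have [t l m0 _ _ am _|_ h0] := bounded_partP t0 x0 (hc k kC).
      exact: countably_coded_inner m0 am.
    by move=> e e0; exists (fun=> 0%N) => x y t _; rewrite !h0 subrr normr0 ltW.
  move=> x y t; apply: le_trans (lipschitz1P (lo k kC) _ _) _.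
  by rewrite /component /linear_part opprD addrACA subrr addr0.
suff H k : (1 <= k <= C)%N -> countably_coded (partial_composition F k).
  by apply: H; rewrite C1 leqnn.
elim: k => [//|[|k] IH] kC; first exact: clin.
have {}IH : countably_coded (partial_composition F k.+1).
  by apply: IH; case/andP: kC => _ kC; exact: ltnW.
apply: countably_coded_contraction
  (countably_coded_combine (comb F k.+2) IH (clin _ kC)) _ => x y t.
by apply: lipschitz1P; apply: ll; case/andP: kC.
Qed.

(** All precisions share one sequence: an index decodes to a precision n and a class m, represented
    by [u i] with radius 1 / (n + 1). Non-codes count as (0, 0), and empty classes are represented
    by [x0]. *)
Lemma countably_codedP f : X -> countably_coded f ->
  exists (u : nat -> X) (e : nat -> R), (forall i, 0 < e i) /\
    forall x n, exists2 i, e i = n.+1%:R^-1 & forall t, `|f x t - f (u i) t| <= e i.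
Proof.
move=> x0 cf.
have e0 n : 0 < n.+1%:R^-1 :> R by rewrite invr_gt0.
pose c n := projT1 (cid (cf _ (e0 n))).
have hc n : forall x y t, c n x = c n y -> `|f x t - f y t| <= n.+1%:R^-1.
  exact: projT2 (cid (cf _ (e0 n))).
pose v n m := if pselect (exists x, c n x = m) is left ex then projT1 (cid ex) else x0.
have hv n x : c n (v n (c n x)) = c n x.
  rewrite /v; case: pselect => [ex|]; last by case; exists x.
  by case: (cid ex).
pose nm i := odflt (0%N, 0%N) (unpickle i).
exists (fun i => v (nm i).1 (nm i).2), (fun i => (nm i).1.+1%:R^-1); split=> // x n.
exists (pickle (n, c n x)); first by rewrite /nm pickleK.
by rewrite /nm pickleK /= => t; apply: hc; rewrite hv.
Qed.

End Codes.

(** * From the sample size to the confidence level *)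

(** Let q be the square root of the logarithm and D = N eps - B. The sample size gives eps sqrt N >=
    s + q, so D >= q sqrt N, and the best exponent - 2 D^2 / N is at most - 2 q^2 = ln delta. *)
Lemma tail_exponent_le (R : realType) (N : nat) (s eps delta : R) :
  (0 < N)%N -> 0 <= s -> 0 < eps -> 0 < delta <= 1 ->
  (s + Num.sqrt (ln (1 / delta `^ (1 / 2)))) ^+ 2 * (eps ^+ 2)^-1 <= N%:R ->
  let B := s * Num.sqrt N%:R in
  exists2 u, 0 <= u &
    expR (u * (B - N%:R * eps) + N%:R * (u ^+ 2 / 8)) <= delta.
Proof.
move=> N0 s0 eps0 /andP[d0 d1] + B.
set q := Num.sqrt _; pose r : R := Num.sqrt N%:R.
have N0' : 0 < N%:R :> R by rewrite ltr0n.
have r0 : 0 < r by rewrite sqrtr_gt0.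
have r2 : r ^+ 2 = N%:R by rewrite sqr_sqrtr// ltW.
have q0 : 0 <= q by exact: sqrtr_ge0.
have q2 : q ^+ 2 = - ln delta / 2.
  have -> : - ln delta / 2 = ln (1 / delta `^ (1 / 2)).
    by rewrite div1r lnV ?posrE ?powR_gt0// ln_powR; lra.
  rewrite sqr_sqrtr// div1r lnV ?posrE ?powR_gt0// ln_powR.
  by rewrite oppr_ge0 pmulr_rle0// ln_le0.
rewrite ler_pdivrMr ?exprn_gt0// -r2 -exprMn ler_pXn2r// ?nnegrE; last 2 first.
- by rewrite addr_ge0.
- by rewrite mulr_ge0 ?ltW.
rewrite r2 => sq.
pose D : R := N%:R * eps - B.
have DE : D = r * (r * eps - s) by rewrite /D /B -/r -r2; ring.
have Dq : r * q <= D by rewrite DE ler_pM2l//; lra.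
have D0 : 0 <= D by apply: le_trans Dq; rewrite mulr_ge0// ltW.
(* The minimizer of - u D + N u^2 / 8. *)
exists (4 * D / N%:R); first by apply: divr_ge0; [exact: mulr_ge0 | exact: ltW].
rewrite [X in expR X](_ : _ = - 2 * (D ^+ 2 / N%:R)); last first.
  have alg (a b : R) : b != 0 ->
      4 * a / b * - a + b * ((4 * a / b) ^+ 2 / 8) = - 2 * (a ^+ 2 / b).
    by move=> b0; field.
  by rewrite -(opprB _ B) -/D alg// gt_eqF.
rewrite -[leRHS]lnK ?posrE// ler_expR.
have : q ^+ 2 <= D ^+ 2 / N%:R.
  rewrite ler_pdivlMr// -r2 mulrC -exprMn ler_pXn2r// nnegrE//.
  by rewrite mulr_ge0// ltW.
rewrite q2; lra.
Qed.

Section Complexity.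
Context (R : realType) (X T : Type) (F : composition R X T).

(** All products are nonnegative, so a single infinite one would make the complexity +oo, above the
    real [y]. *)
Lemma sample_complexity_finite C gamma eps delta (y : R) : X -> T ->
  0 < gamma -> 0 < eps -> (sample_complexity F C gamma eps delta <= y%:E)%E ->
  exists2 c : nat -> R,
    (forall k, (1 <= k <= C)%N -> (tau F k * Lambda F k)%E = (c k)%:E) &
    0 <= \sum_(1 <= k < C.+1) c k /\
    (2 / gamma * (\sum_(1 <= k < C.+1) c k) + Num.sqrt (ln (1 / delta `^ (1 / 2)))) ^+ 2
      * (eps ^+ 2)^-1 <= y.
Proof.
move=> x0 t0 gamma0 eps0; rewrite /sample_complexity.
have tl0 k : (0 <= tau F k * Lambda F k)%E by rewrite mule_ge0 ?tau_ge0 ?Lambda_ge0.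
set S := (\sum_(_ <= _ < _) _)%E.
have S0 : (0 <= S)%E by apply: sume_ge0 => k _.
case: (boolP (S \is a fin_num)) => [fS|nS]; last first.
  have -> : S = +oo%E by move: nS S0; case: (S).
  rewrite gt0_muley ?lte_fin ?divr_gt0// addye// expe2 mulyy gt0_mulye//.
  by rewrite lte_fin invr_gt0 exprn_gt0.
pose c k := fine (tau F k * Lambda F k)%E.
have hc k : (1 <= k <= C)%N -> (tau F k * Lambda F k)%E = (c k)%:E.
  move=> kC; rewrite fineK//.
  move: fS; rewrite sum_fin_num => /allP; apply; apply/mapP; exists k => //.
  by rewrite mem_filter /= mem_index_iota ltnS.
have SE : S = (\sum_(1 <= k < C.+1) c k)%:E.
  rewrite /S -sumEFin big_nat_cond [RHS]big_nat_cond; apply: eq_bigr => k.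
  by rewrite andbT ltnS => /hc.
rewrite SE => H; exists c => //; split; first by rewrite -lee_fin -SE.
by rewrite -lee_fin.
Qed.

End Complexity.

(** * The bound for all points at once, by passage to the limit *)

Section UniformBound.
Context d (T : measurableType d) (R : realType) (P : probability T R) (X : Type).
Context d' (W : measurableType d') (Q : probability W R) (N : nat).
Context (theta : 'I_N -> {RV Q >-> T}) (htheta : independent_copies P theta).
Context (f : X -> T -> R) (mf : forall x, measurable_fun [set: T] (f x)).
Context (gamma eps delta : R) (gamma0 : 0 < gamma) (N0 : (0 < N)%N).

Local Notation loss x t := (margin_loss gamma (f x t)).

(** On [G n] the first n + 1 points [v i] satisfy the bound up to 1 / (n + 1) and e i / gamma. As
    [B] is the same for any number of points, each [G n], and so their intersection, has probability
    at least 1 - delta; there the slack 1 / (n + 1) disappears, and every x is reached by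
    approximation. *)
Lemma uniform_violation_bound (B u : R) (x0 : X) :
  countably_coded f ->
  (forall (m : nat) (x : 'I_m.+1 -> X) (s : seq T), size s = N ->
    rademacher ord0 (fun i t => 2 * loss (x i) t) s (fun=> 0) <= B) ->
  0 <= u -> expR (u * (B - N%:R * eps) + N%:R * (u ^+ 2 / 8)) <= delta ->
  holds_with_probability Q (1 - delta)
    [set w | forall x : X, (violation P f x <=
       (empirical_margin_risk gamma f (fun i => theta i w) x + eps)%:E)%E].
Proof.
move=> cf radB u0 tail.
have N0' : 0 < N%:R :> R by rewrite ltr0n.
have [v [e [e0 hv]]] := countably_codedP x0 cf.
(* If |f x - f (v i)| <= e i, then f x > 0 implies the event U i. *)
pose U i := [set t | - e i < f (v i) t].
have mU i : measurable (U i).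
  rewrite -[U i]setTI; have -> : U i = f (v i) @^-1` `]- e i, +oo[.
    by apply/seteqP; split=> t /=; rewrite in_itv/= andbT.
  exact: mf.
have mloss x : measurable_fun setT (fun t => loss x t) by exact: measurable_margin_loss.
pose bad n i := [set w | N%:R * eps + N%:R * n.+1%:R^-1 <=
  N%:R * (fine (P (U i)) - e i / gamma) - \sum_j loss (v i) (theta j w)].
have mbad n i : measurable (bad n i).
  pose g w := N%:R * (fine (P (U i)) - e i / gamma) - \sum_j loss (v i) (theta j w).
  rewrite -[bad n i]setTI.
  have -> : bad n i = g @^-1` `[N%:R * eps + N%:R * n.+1%:R^-1, +oo[.
    by apply/seteqP; split=> w /=; rewrite in_itv/= andbT.
  suff : measurable_fun setT g by apply.
  apply: measurable_funB => //.
  apply: measurable_sum => j.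
  exact: (measurableT_comp (mloss (v i)) (measurable_funP (theta j))).
pose G n := ~` \big[setU/set0]_(i < n.+1) bad n i.
have mG n : measurable (G n) by apply: measurableC; exact: bigsetU_measurable.
have QG n : ((1 - delta)%:E <= Q (G n))%E.
  rewrite /G probability_setC ?EFinB; last exact: bigsetU_measurable.
  apply: leeB => //; apply: (@le_trans _ _ (expR (u * (B - N%:R * eps) + N%:R * (u ^+ 2 / 8)))%:E); last first.
    by rewrite lee_fin.
  apply: (@sample_deviation _ _ W T R P Q N theta htheta 'I_n.+1 ord0
    (fun i => fun t => loss (v i) t) (fun i => U i) (fun i => e i / gamma)
    _ _ _ _ _ B u (N%:R * eps) n.+1%:R^-1).
  - by move=> i; exact: mloss.
  - by move=> i t; exact: margin_loss01.
  - by move=> i; exact: mU.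
  - by move=> i; rewrite divr_ge0// ltW.
  - by move=> i t /= Ut; apply: margin_loss_near1 => //; rewrite ltW.
  - by move=> s sN; exact: (radB n (fun i => v i)).
  - exact: u0.
  - by rewrite invr_gt0.
  - exact: bigsetU_measurable.
  - by move=> w; rewrite -(bigcup_mkord n.+1 (bad n)) => -[i /= ni H]; exists (Ordinal ni).
(* A larger index adds points and shrinks the slack, so more samples are bad. *)
have Gdec : {homo G : n m / (n <= m)%N >-> (m <= n)%O}.
  move=> n m nm; apply/subsetPset; apply: subsetC => w.
  rewrite -!bigcup_mkord => -[i /= im H]; exists i => /=; first exact: leq_trans im _.
  apply: le_trans H; rewrite lerD2l ler_pM2l// lef_pV2 ?posrE// ler_nat; exact: nm.
exists (\bigcap_n G n); split.
- exact: bigcapT_measurable.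
- move=> w Gw x.
  have good i : fine (P (U i)) - e i / gamma
      <= empirical_margin_risk gamma f (fun j => theta j w) (v i) + eps.
    apply/ler_addgt0Pr => z z0.
    (* The summand [i] puts [v i] among the first n + 1 points; the other one makes the slack at
       most [z]. *)
    pose n := (i + (Num.truncn z^-1))%N.
    have nz : n.+1%:R^-1 <= z.
      rewrite invf_ple ?posrE// (le_trans (ltW (truncnS_gt _)))// ler_nat.
      by rewrite /n ltnS leq_addl.
    have := Gw n Logic.I; rewrite /G -bigcup_mkord => Gnw.
    have : ~ bad n i w.
      by move=> H; apply: Gnw; exists i => //=; rewrite ltnS leq_addr.
    rewrite /bad/= => /negP; rewrite -ltNge => H.
    rewrite -(@ler_pM2l _ N%:R)// /empirical_margin_risk !mulrDr mulrA divff ?gt_eqF//.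
    rewrite mul1r; have : N%:R * n.+1%:R^-1 <= N%:R * z by rewrite ler_pM2l.
    have alg (a p g s b r y : R) : a * (p - g) - s < a * b + r -> r <= a * y ->
      a * p + a * - g <= s + a * b + a * y by rewrite mulrBr mulrN; lra.
    exact: alg.
  have risk_close i r : (forall t, `|f x t - f (v i) t| <= r) ->
      empirical_margin_risk gamma f (fun j => theta j w) (v i)
      <= empirical_margin_risk gamma f (fun j => theta j w) x + r / gamma.
    move=> xr; rewrite -(@ler_pM2l _ N%:R)// /empirical_margin_risk mulrDr.
    rewrite !mulrA divff ?gt_eqF// !mul1r.
    have -> : N%:R * r / gamma = \sum_(j < N) (r / gamma).
      by rewrite sumr_const card_ord -mulrA mulr_natl.
    rewrite -big_split/=; apply: ler_sum => j _.
    have := margin_loss_lipschitz gamma0 (f (v i) (theta j w)) (f x (theta j w)).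
    have : `|f (v i) (theta j w) - f x (theta j w)| / gamma <= r / gamma.
      by rewrite ler_pM2r ?invr_gt0// distrC.
    have := ler_norm (loss (v i) (theta j w) - loss x (theta j w)).
    lra.
  have mV : measurable [set t | 0 < f x t].
    rewrite -[X in measurable X]setTI.
    have -> : [set t | 0 < f x t] = f x @^-1` `]0, +oo[.
      by apply/seteqP; split=> t /=; rewrite in_itv/= andbT.
    exact: mf.
  rewrite -(@fineK _ (violation P f x)) ?fin_num_measure// lee_fin.
  apply/ler_addgt0Pr => z z0.
  (* The error e i / gamma occurs twice: in [good], for the event [U i], and in [risk_close], for
     replacing [x] by [v i]. *)
  pose n := Num.truncn (2 / (gamma * z)).
  have nz : 2 * n.+1%:R^-1 / gamma <= z.
    rewrite ler_pdivrMr// ler_pdivrMr// mulrC (mulrC z).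
    by rewrite -ler_pdivrMr ?mulr_gt0// ltW// truncnS_gt.
  have [i ei xi] := hv x n.
  have VU : fine (violation P f x) <= fine (P (U i)).
    rewrite fine_le ?fin_num_measure// le_measure ?inE// => t /= ft.
    rewrite /U/=; have := xi t; rewrite ler_norml => /andP[_]; lra.
  have {}nz : e i / gamma + e i / gamma <= z.
    by rewrite ei -mulr2n -(mulr_natl (_ / _)) mulrA.
  have goodi := good i; have closei := risk_close i _ xi; clear - nz VU goodi closei.
  lra.
(* Continuity from above carries the lower bound on each [Q (G n)] to the intersection. *)
- have cvgG := @nonincreasing_cvg_mu _ _ _ Q G _ mG _ Gdec.
  rewrite -(cvg_lim _ (cvgG _ _)) //=.
  + apply: lime_ge; last by near=> n; exact: QG.
    apply/cvg_ex; eexists; apply: cvgG; last exact: bigcapT_measurable.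
    by apply: (le_lt_trans (probability_le1 _ (mG 0%N))); rewrite ltry.
  + by apply: (le_lt_trans (probability_le1 _ (mG 0%N))); rewrite ltry.
  + exact: bigcapT_measurable.
Unshelve. all: by end_near.
Qed.

End UniformBound.

Theorem corollary2 (R : realType) (X : Type)
    (d : measure_display) (T : measurableType d) (P : probability T R)
    (C : nat) (hC : (1 <= C)%N) (F : composition R X T)
    (hF : nonexpansive_composition F C)
    (f : X -> T -> R) (hf : f = partial_composition F C)
    (mf : forall x : X, measurable_fun [set: T] (f x))
    (gamma eps delta : R) (hgamma : 0 < gamma) (heps : 0 < eps)
    (hdelta : 0 < delta <= 1)
    (d' : measure_display) (W : measurableType d') (Q : probability W R)
    (N : nat) (theta : 'I_N -> {RV Q >-> T})
    (htheta : independent_copies P theta) :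
  [/\ (sample_complexity F C gamma eps delta <= N%:R%:E)%E ->
      holds_with_probability Q (1 - delta)
        [set w | forall x : X,
          (violation P f x <=
           (empirical_margin_risk gamma f (fun i => theta i w) x + eps)%:E)%E],
      forall (w : W) (x : X),
        hard_margin_solution gamma f (fun i => theta i w) x ->
        empirical_margin_risk gamma f (fun i => theta i w) x = 0
    & (sample_complexity F C gamma eps delta <= N%:R%:E)%E ->
      holds_with_probability Q (1 - delta)
        [set w | forall x : X,
          hard_margin_solution gamma f (fun i => theta i w) x ->
          (violation P f x <= eps%:E)%E]].
Proof.
have [d0 d1] := andP hdelta.
have hard w x : hard_margin_solution gamma f (fun i => theta i w) x ->
    empirical_margin_risk gamma f (fun i => theta i w) x = 0.
  move=> hx; rewrite /empirical_margin_risk big1 ?mulr0// => i _.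
  exact: margin_loss_eq0 (hx i).
have bound : (sample_complexity F C gamma eps delta <= N%:R%:E)%E ->
    holds_with_probability Q (1 - delta) [set w | forall x : X,
      (violation P f x <=
       (empirical_margin_risk gamma f (fun i => theta i w) x + eps)%:E)%E].
  move=> hN.
  (* At delta = 1 the complexity may vanish and admit N = 0, but only probability at least 0 is
     asked. *)
  have [delta1|delta1] := eqVneq delta 1.
    by exists set0; split=> //; rewrite delta1 subrr measure0.
  have [[x0]|noX] := pselect (inhabited X); last first.
    exists setT; split=> //; first by move=> w _ x; case: noX; exists.
    by rewrite probability_setT lee_fin lerBlDr lerDl ltW.
  have [t0 _] : exists t : T, True.
    apply/not_existsP => noT.
    have : P setT = 0%E.
      by rewrite (_ : setT = set0) ?measure0//; apply/seteqP; split=> // t.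
    by rewrite probability_setT => -[] /eqP; rewrite oner_eq0.
  have [c hc [c0 hcN]] := sample_complexity_finite x0 t0 hgamma heps hN.
  have g0 : 0 <= 2 / gamma by rewrite divr_ge0// ltW.
  (* For delta < 1 the logarithm is positive, hence so is the complexity. *)
  have N0 : (0 < N)%N.
    rewrite -(ltr0n R); apply: lt_le_trans hcN.
    apply: mulr_gt0; last by rewrite invr_gt0 exprn_gt0.
    apply/exprn_gt0/ltr_wpDl; first exact: mulr_ge0.
    rewrite sqrtr_gt0 div1r lnV ?posrE ?powR_gt0// ln_powR oppr_gt0 pmulr_rlt0//.
    by rewrite ln_lt0// d0 lt_neqAle delta1.
  have [u u0 tail] := tail_exponent_le N0 (mulr_ge0 g0 c0) heps hdelta hcN.
  apply: uniform_violation_bound tail => //.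
    by rewrite hf; exact (countably_coded_composition t0 hF hC hc).
  move=> m x s sN.
  (* Increments of twice the loss are at most those of f scaled by 2 / gamma, so contraction removes
     the loss. *)
  rewrite -mulrA -sN; apply: le_trans
    (ler_wpM2l g0 (rademacher_composition_bound ord0 x t0 s hF hC hc)).
  rewrite -hf -rademacher_scale//; apply: rademacher_contraction => t i j.
  rewrite -!mulrBr normrM [leRHS]normrM (ger0_norm g0) ger0_norm// -mulrA ler_pM2l//.
  by rewrite mulrC; exact: margin_loss_lipschitz.
(* The event covers all x simultaneously, hence also solutions that depend on the sample, whose
   empirical risk is 0. *)
split=> // hN; have [A [mA Abound PA]] := bound hN.
exists A; split=> // w /Abound Aw x hx.
by have := Aw x; rewrite hard// add0r.
Qed.
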